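(* Let $\mathbf{k}$ be a field and $\Gamma$ a nontrivial ordered abelian group, and let $K=\mathbf{k}((t^\Gamma))$, viewed as an $L$-structure with $L=\{0,1,+,\times,\mathcal{O},\mathfrak{M},V\}$ where $\mathcal{O}$ is interpreted as the valuation ring, $\mathfrak{M}$ as the canonical monomial group $t^\Gamma$, and $V$ as the canonical additive complement of $\mathcal{O}$. Then the $L$-structure $K$ interprets the two-sorted structure $(\mathbb{N},\mathcal{P}(\mathbb{N});+,\in)$.
   Context: $\mathbf{k}((t^\Gamma))$ is the Hahn series field: the set of formal series $f=\sum_{\gamma\in\Gamma}f_\gamma t^\gamma$ with $f_\gamma\in\mathbf{k}$ whose support $\operatorname{supp}(f)=\{\gamma: f_\gamma\neq 0\}$ is well-ordered, with componentwise addition and the usual convolution multiplication $fg=\sum_\gamma(\sum_{\alpha+\beta=\gamma}f_\alpha g_\beta)t^\gamma$. The valuation ring $\mathcal{O}$ is the set of $f$ with $\operatorname{supp}(f)\subseteq\Gamma^{\geq 0}$; the canonical monomial group is $t^\Gamma=\{t^\gamma:\gamma\in\Gamma\}$; the canonical additive complement $V$ is the set of purely infinite series, i.e. $f$ with $\operatorname{supp}(f)\subseteq\Gamma^{<0}$. $(\mathbb{N},\mathcal{P}(\mathbb{N});+,\in)$ is the two-sorted structure consisting of $\mathbb{N}=\{0,1,\ldots\}$ with addition, its power set, and the membership relation $\in\subseteq\mathbb{N}\times\mathcal{P}(\mathbb{N})$. *)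

(* Defs.v *)
From HB Require Import structures.
From mathcomp Require Import all_boot all_order all_algebra.
From mathcomp Require Import boolp classical_sets functions cardinality fsbigop.
From mathcomp Require Import wochoice.

Set Implicit Arguments.
Unset Strict Implicit.
Unset Printing Implicit Defensive.

Import Order.TTheory GRing.Theory Num.Theory.
Local Open Scope classical_set_scope.
Local Open Scope ring_scope.

(** Totality is a field here because a structure built on [Order.Total] would
    need a join with [Num.RealDomain] that can no longer be declared. *)
HB.mixin Record POrderedZmodule_isOrdered G of Num.POrderedZmodule G := {
  oz_le_total : total (<=%R : rel G);
  oz_leD2r_subproof : forall z x y : G, x <= y -> x + z <= y + z
}.

#[short(type="orderedZmodType")]
HB.structure Definition OrderedZmodule :=
  { G of Num.POrderedZmodule G & POrderedZmodule_isOrdered G }.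

Section OrderedZmoduleTheory.
Variable G : orderedZmodType.
Implicit Types (x y z : G) (A B : {pred G}).

Lemma oz_comparable x y : x >=< y.
Proof. exact: oz_le_total. Qed.

Lemma oz_leNgt x y : (x <= y) = ~~ (y < x).
Proof. exact/comparable_leNgt/oz_comparable. Qed.

Lemma oz_ltNge x y : (x < y) = ~~ (y <= x).
Proof. exact/comparable_ltNge/oz_comparable. Qed.

Lemma oz_leD2r z x y : (x + z <= y + z) = (x <= y).
Proof.
apply/idP/idP; last exact: oz_leD2r_subproof.
by move=> /(oz_leD2r_subproof (- z)); rewrite !addrK.
Qed.

Lemma oz_leD2l z x y : (z + x <= z + y) = (x <= y).
Proof. by rewrite ![z + _]addrC oz_leD2r. Qed.

Lemma oz_ltD2r z x y : (x + z < y + z) = (x < y).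
Proof. by rewrite !oz_ltNge oz_leD2r. Qed.

Lemma wo_chain_leP A :
  wo_chain <=%R A <->
  forall S : set G, (forall x, S x -> x \in A) -> S !=set0 ->
    exists2 z, S z & forall x, S x -> z <= x.
Proof.
split=> [woA S SA [x Sx]|woA].
  have [||z [[zS zmin] _]] := woA (mem S).
  - by move=> y; rewrite inE => /SA.
  - by exists x; rewrite inE.
  by exists z => [|y Sy]; [rewrite inE in zS|apply: zmin; rewrite inE].
apply: antisymmetric_wo_chain => [x y _ _|S SA [x xS]]; first exact: le_anti.
have [|z zS zmin] := woA [set y | y \in S] SA; first by exists x.
by exists z; split=> // y yS; apply: zmin.
Qed.

Lemma wo_chain_ind A (P : G -> Prop) : wo_chain <=%R A ->
  (forall x, x \in A -> (forall y, y \in A -> y < x -> P y) -> P x) ->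
  forall x, x \in A -> P x.
Proof.
move=> /wo_chain_leP woA IH x xA; apply: contrapT => nPx.
have [|y [yA nPy] ymin] := woA [set y | y \in A /\ ~ P y] (fun y H => H.1).
  by exists x.
apply: nPy; apply: IH => // z zA zy; apply: contrapT => nPz.
by have := ymin z (conj zA nPz); rewrite oz_leNgt zy.
Qed.

Lemma wo_chainS A B : {subset A <= B} -> wo_chain <=%R B -> wo_chain <=%R A.
Proof.
move=> AB /wo_chain_leP woB; apply/wo_chain_leP => S SA.
by apply: woB => x /SA/AB.
Qed.

Lemma wo_chain_set1 x : wo_chain <=%R (pred1 x).
Proof.
apply/wo_chain_leP => S Sx [y Sy].
by exists y => // z Sz; rewrite (eqP (Sx y Sy)) (eqP (Sx z Sz)).
Qed.

Lemma wo_chainU A B : wo_chain <=%R A -> wo_chain <=%R B ->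
  wo_chain <=%R [predU A & B].
Proof.
move=> /wo_chain_leP woA /wo_chain_leP woB; apply/wo_chain_leP => S SAB S0.
pose SA := S `&` [set x | x \in A]; pose SB := S `&` [set x | x \in B].
have SAoB x : S x -> SA x \/ SB x.
  by move=> Sx; case/orP: (SAB x Sx) => ?; [left|right].
have [A0|/set0P/negP/negPn/eqP A0] := pselect (SA !=set0); last first.
  have SBS x : S x -> SB x by case/SAoB; rewrite // A0.
  have [||z [Sz _] zmin] := woB SB; first by move=> x [].
    by case: S0 => x /SBS; exists x.
  by exists z => // x /SBS /zmin.
have [a [Sa _] amin] := woA SA (fun x H => H.2) A0.
have [B0|/set0P/negP/negPn/eqP B0] := pselect (SB !=set0); last first.
  by exists a => // x Sx; case: (SAoB x Sx) => [/amin//|]; rewrite B0.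
have [b [Sb _] bmin] := woB SB (fun x H => H.2) B0.
case: (comparable_leP (oz_comparable a b)) => ab.
  by exists a => // x /SAoB[/amin//|/bmin]; apply: le_trans.
by exists b => // x /SAoB[/amin|/bmin//]; apply: le_trans (ltW ab).
Qed.

Lemma wo_chainD A B : wo_chain <=%R A -> wo_chain <=%R B ->
  wo_chain <=%R
    [pred g | `[< exists a b, [/\ a \in A, b \in B & a + b = g] >]].
Proof.
move=> woA /wo_chain_leP woB.
have below a : a \in A -> forall S : set G, S !=set0 ->
    (forall x, S x -> exists a' b, [/\ a' \in A, a' < a, b \in B & a' + b = x]) ->
    exists2 z, S z & forall x, S x -> z <= x.
  move: a; apply: (wo_chain_ind woA) => a aA IH S [s Ss] Sdec.
  pose Bs := [set b | b \in B /\ exists2 a', (a' \in A) && (a' < a) & S (a' + b)].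
  have [||b0 [b0B [a0 /andP[a0A a0a] Sab0]] b0min] := woB Bs; first by move=> x [].
    have [a' [b [a'A a'a bB sE]]] := Sdec s Ss; exists b; split=> //.
    by exists a'; rewrite ?a'A // sE.
  have [[s1 [Ss1 s1lt]]|nS] := pselect (exists s1, S s1 /\ s1 < a0 + b0);
    last first.
    by exists (a0 + b0) => // x Sx; rewrite oz_leNgt; apply/negP => xlt; apply: nS;
      exists x.
  have [||z [Sz zlt] zmin] := IH a0 a0A a0a [set x | S x /\ x < a0 + b0].
  - by exists s1.
  - move=> x [Sx xlt]; have [a' [b [a'A a'a bB xE]]] := Sdec x Sx.
    exists a', b; split=> //.
    have b0b : b0 <= b.
      by apply: b0min; split=> //; exists a'; rewrite ?a'A // xE.
    rewrite -(oz_ltD2r b0); apply: le_lt_trans xlt.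
    by rewrite -xE oz_leD2l.
  exists z => // x Sx; have [xlt|] := comparable_ltP (oz_comparable x (a0 + b0)); first exact: zmin.
  by apply: le_trans; apply: ltW.
apply/wo_chain_leP => S SAB [s Ss].
have dec x : S x -> exists a b, [/\ a \in A, b \in B & a + b = x].
  by move=> /SAB/asboolP.
pose Bs := [set b | b \in B /\ exists2 a, a \in A & S (a + b)].
have [||b0 [b0B [a0 a0A Sab0]] b0min] := woB Bs; first by move=> x [].
  have [a [b [aA bB sE]]] := dec s Ss; exists b; split=> //.
  by exists a; rewrite // sE.
have [[s1 [Ss1 s1lt]]|nS] := pselect (exists s1, S s1 /\ s1 < a0 + b0);
  last first.
  by exists (a0 + b0) => // x Sx; rewrite oz_leNgt; apply/negP => xlt; apply: nS;
    exists x.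
have [||z [Sz zlt] zmin] := below a0 a0A [set x | S x /\ x < a0 + b0].
- by exists s1.
- move=> x [Sx xlt]; have [a [b [aA bB xE]]] := dec x Sx.
  exists a, b; split=> //.
  have b0b : b0 <= b.
    by apply: b0min; split=> //; exists a; rewrite // xE.
  rewrite -(oz_ltD2r b0); apply: le_lt_trans xlt.
  by rewrite -xE oz_leD2l.
exists z => // x Sx; have [xlt|] := comparable_ltP (oz_comparable x (a0 + b0)); first exact: zmin.
by apply: le_trans; apply: ltW.
Qed.

Lemma wo_chain_finite_fiber A B z : wo_chain <=%R A -> wo_chain <=%R B ->
  finite_set [set ab : G * G | [/\ ab.1 \in A, ab.2 \in B & ab.1 + ab.2 = z]].
Proof.
move=> woA /wo_chain_leP woB.
pose T := [set a | a \in A /\ z - a \in B].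
have Tmax (S : set G) : S `<=` T -> S !=set0 -> exists2 m, S m & forall x, S x -> x <= m.
  move=> ST [s Ss].
  have [||_ [m Sm <-] mmin] := woB [set z - a | a in S].
  - by move=> _ [a /ST[_ zaB] <-].
  - by exists (z - s), s.
  exists m => // x Sx; have := mmin (z - x) (ex_intro2 _ _ x Sx erefl).
  by rewrite oz_leD2l -(oz_leD2r (x + m)) addrCA addNr addr0 [x + m]addrC addrCA
    addNr addr0.
have Tfin a : a \in A -> finite_set (T `&` [set x | x <= a]).
  move: a; apply: (wo_chain_ind woA) => a aA IH.
  have sub : T `&` [set x | x <= a] `<=`
             (T `&` [set x | x < a]) `|` [set a].
    move=> x [Tx /=]; rewrite le_eqVlt => /orP[/eqP->|xa]; first by right.
    by left.
  apply: (sub_finite_set sub); rewrite finite_setU; split; last first.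
    exact: finite_set1.
  have [T0|/set0P/negP/negPn/eqP->] := pselect (T `&` [set x | x < a] !=set0);
    last exact: finite_set0.
  have [|m [[mA mB] ma] mmax] := Tmax (T `&` [set x | x < a]) _ T0.
    by move=> x [].
  apply: sub_finite_set (IH m mA ma) => x [Tx xa]; split=> //.
  exact: mmax.
have finT : finite_set T.
  have [T0|/set0P/negP/negPn/eqP->] := pselect (T !=set0);
    last exact: finite_set0.
  have [|m [mA _] mmax] := Tmax T _ T0; first by [].
  by apply: sub_finite_set (Tfin m mA) => x Tx; split=> //; apply: mmax.
apply: sub_finite_set (finite_image (fun a => (a, z - a)) finT).
move=> [a b] /= [aA bB abz].
have zaE : z - a = b by rewrite -abz [a + b]addrC addrK.
by exists a; rewrite ?zaE //; split; rewrite ?zaE.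
Qed.

End OrderedZmoduleTheory.

Arguments wo_chain_set1 {G} x.
Arguments wo_chain_finite_fiber {G A B} z.

Section Hahn.
Variables (k : fieldType) (G : orderedZmodType).

Definition supp (f : G -> k) : {pred G} := [pred g | f g != 0].

Record hahn := Hahn {
  coef :> G -> k;
  supp_wo : wo_chain <=%R (supp coef)
}.

Arguments supp_wo : clear implicits.

Lemma hahnP (f g : hahn) : coef f =1 coef g -> f = g.
Proof.
case: f g => [f fP] [g gP] /= /funext fg; subst g.
by congr Hahn; apply: Prop_irrelevance.
Qed.

Lemma hahn_monomial_subproof (c : G) :
  wo_chain <=%R (supp (fun g => (g == c)%:R)).
Proof.
apply: wo_chainS (wo_chain_set1 c) => g; rewrite !inE.
by case: (g == c); rewrite // eqxx.
Qed.

Lemma hahn_zero_subproof : wo_chain <=%R (supp (fun=> 0)).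
Proof. by apply: wo_chainS (wo_chain_set1 0) => g; rewrite !inE eqxx. Qed.

Lemma hahn_add_subproof (f g : hahn) :
  wo_chain <=%R (supp (fun c => f c + g c)).
Proof.
apply: wo_chainS (wo_chainU (supp_wo f) (supp_wo g)) => c.
rewrite !inE; apply: contraR; rewrite negb_or !negbK.
by move=> /andP[/eqP-> /eqP->]; rewrite addr0.
Qed.

Definition hahn_mul_coef (f g : hahn) (c : G) : k :=
  \sum_(ab \in [set ab : G * G | ab.1 + ab.2 = c]) f ab.1 * g ab.2.

(** The sum above has finitely many nonzero terms, so the default value of
    [\sum_(_ \in _) _] for infinite supports is never used. *)
Lemma hahn_mul_coef_finite (f g : hahn) (c : G) :
  finite_set ([set ab : G * G | ab.1 + ab.2 = c] `&`
              (fun ab => f ab.1 * g ab.2) @^-1` [set~ 0]).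
Proof.
apply: sub_finite_set (wo_chain_finite_fiber c (supp_wo f) (supp_wo g)).
move=> [a b] /= [abc /eqP]; rewrite mulf_eq0 negb_or => /andP[fa gb].
by split.
Qed.

Lemma hahn_mul_subproof (f g : hahn) :
  wo_chain <=%R (supp (hahn_mul_coef f g)).
Proof.
apply: wo_chainS (wo_chainD (supp_wo f) (supp_wo g)) => c.
rewrite inE => fgc.
suff ex : exists a b, [/\ a \in supp f, b \in supp g & a + b = c] by exact: asboolT.
apply: contrapT => nex; move/eqP: fgc; apply; rewrite /hahn_mul_coef.
apply: fsbig1 => -[a b] /= abc.
apply/eqP; rewrite mulf_eq0; apply/negPn/negP; rewrite negb_or => /andP[fa gb].
by apply: nex; exists a, b.
Qed.

Arguments hahn_monomial_subproof : clear implicits.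
Arguments hahn_zero_subproof : clear implicits.
Arguments hahn_add_subproof : clear implicits.
Arguments hahn_mul_subproof : clear implicits.

(** [hahn_monomial c] is t^c. *)
Definition hahn_monomial c := Hahn (hahn_monomial_subproof c).
Definition hahn_zero := Hahn hahn_zero_subproof.
Definition hahn_one := hahn_monomial 0.
Definition hahn_add f g := Hahn (hahn_add_subproof f g).
Definition hahn_mul f g := Hahn (hahn_mul_subproof f g).

Definition valuation_ring (f : hahn) : Prop :=
  forall c, c \in supp f -> 0 <= c.
Definition monomial_group (f : hahn) : Prop := exists c, f = hahn_monomial c.
Definition purely_infinite (f : hahn) : Prop :=
  forall c, c \in supp f -> c < 0.

End Hahn.

Record language := Language {
  fsym : Type; farity : fsym -> nat;
  rsym : Type; rarity : rsym -> nat
}.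

Section Syntax.
Variable L : language.

Inductive term :=
| Var of nat
| App (f : fsym L) of 'I_(farity f) -> term.

Inductive formula :=
| Equal of term & term
| Rel (r : rsym L) of 'I_(rarity r) -> term
| Not of formula
| And of formula & formula
| Or of formula & formula
| Implies of formula & formula
| Forall of nat & formula
| Exists of nat & formula.

Record structure := Structure {
  carrier :> Type;
  fint : forall f : fsym L, ('I_(farity f) -> carrier) -> carrier;
  rint : forall r : rsym L, ('I_(rarity r) -> carrier) -> Prop
}.

Fixpoint eval (M : structure) (e : nat -> M) (t : term) : M :=
  match t with
  | Var i => e i
  | App f a => fint (fun i => eval e (a i))
  end.

Fixpoint holds (M : structure) (e : nat -> M) (phi : formula) : Prop :=
  match phi with
  | Equal t u => eval e t = eval e u
  | Rel r a => rint (fun i => eval e (a i))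
  | Not p => ~ holds e p
  | And p q => holds e p /\ holds e q
  | Or p q => holds e p \/ holds e q
  | Implies p q => holds e p -> holds e q
  | Forall i p => forall x : M, holds [eta e with i |-> x] p
  | Exists i p => exists x : M, holds [eta e with i |-> x] p
  end.

(** A subset of M^n is given by a predicate on sequences, of which only the
    sequences of length n matter.  In the assignment below the variables
    0, ..., n-1 stand for the coordinates of x, and the values of [e] at the
    other variables are the parameters: there are finitely many of them, since
    [phi] mentions finitely many variables. *)
Definition definable (M : structure) (n : nat) (X : seq M -> Prop) : Prop :=
  exists (phi : formula) (e : nat -> M),
    forall x : n.-tuple M, X x <-> holds (fun i => nth (e i) x i) phi.

End Syntax.

Record signature := Signature {
  sort : Type;
  msfsym : Type; dom : msfsym -> seq sort; cod : msfsym -> sort;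
  msrsym : Type; rdom : msrsym -> seq sort
}.

Fixpoint product (T : Type) (A : T -> Type) (w : seq T) : Type :=
  if w is s :: w' then (A s * product A w')%type else unit.

Record msstructure (S : signature) := MSStructure {
  mscarrier :> sort S -> Type;
  msfint : forall f : msfsym S, product mscarrier (dom f) -> mscarrier (cod f);
  msrint : forall r : msrsym S, product mscarrier (rdom r) -> Prop
}.

Section Interpretation.
Variables (L : language) (M : structure L).
Variables (S : signature) (N : msstructure S).
Variables (d : sort S -> nat).
Variables (D : forall s : sort S, seq M -> Prop) (pi : forall s : sort S, seq M -> N s).

Definition dims (w : seq (sort S)) : nat := sumn [seq d s | s <- w].

(** With w = [:: s1; ...; sm], [pullback R x] says that x is a concatenation
    x1 ++ ... ++ xm, with xi of length d si and in the domain D si, such that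
    R holds at (pi s1 x1, ..., pi sm xm). *)
Fixpoint pullback (w : seq (sort S)) :
    (product N w -> Prop) -> seq M -> Prop :=
  match w with
  | [::] => fun R _ => R tt
  | s :: w' => fun R x =>
      D s (take (d s) x) /\
      @pullback w' (fun b => R (pi s (take (d s) x), b)) (drop (d s) x)
  end.

(** [pi s] is the coordinate map from the domain [D s], a definable subset of
    M^(d s), onto the sort s of N.  The preimages under the coordinate maps of
    equality on each sort, of each relation, and of the graph of each function
    (with the value as first coordinate) are definable. *)
Definition is_interpretation : Prop :=
  [/\ forall s, definable (d s) (D s),
      forall s (a : N s), exists2 x : (d s).-tuple M, D s x & pi s x = a,
      forall s, definable (dims [:: s; s])
        (pullback (w := [:: s; s]) (fun ab => ab.1 = ab.2.1)),
      forall r : msrsym S, definable (dims (rdom r))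
        (pullback (w := rdom r) (@msrint S N r))
    & forall f : msfsym S, definable (dims (cod f :: dom f))
        (pullback (w := cod f :: dom f) (fun ba => ba.1 = msfint ba.2))].

End Interpretation.

(** Parameters are allowed, since [definable] allows them. *)
Definition interprets (L : language) (M : structure L)
    (S : signature) (N : msstructure S) : Prop :=
  exists (d : sort S -> nat) (D : forall s : sort S, seq M -> Prop)
         (pi : forall s : sort S, seq M -> N s),
    is_interpretation d D pi.

Variant hahn_fsym := FZero | FOne | FAdd | FMul.
Variant hahn_rsym := RValuationRing | RMonomialGroup | RComplement.

Definition hahn_language : language := {|
  farity := fun f => match f with FZero | FOne => 0%N | FAdd | FMul => 2%N end;
  rarity := fun _ : hahn_rsym => 1%N
|}.

Definition hahn_structure (k : fieldType) (G : orderedZmodType) :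
    structure hahn_language := {|
  carrier := hahn k G;
  fint := fun f : fsym hahn_language =>
    match f return ('I_(@farity hahn_language f) -> hahn k G) -> hahn k G with
    | FZero => fun _ => hahn_zero k G
    | FOne => fun _ => hahn_one k G
    | FAdd => fun a => hahn_add (a ord0) (a ord_max)
    | FMul => fun a => hahn_mul (a ord0) (a ord_max)
    end;
  rint := fun r : rsym hahn_language =>
    match r return ('I_(@rarity hahn_language r) -> hahn k G) -> Prop with
    | RValuationRing => fun a => valuation_ring (a ord0)
    | RMonomialGroup => fun a => monomial_group (a ord0)
    | RComplement => fun a => purely_infinite (a ord0)
    end
|}.

Variant nat_sort := NumSort | PowSort.

Definition nat_pow_signature : signature := {|
  sort := nat_sort;
  msfsym := unit; dom := fun _ => [:: NumSort; NumSort]; cod := fun _ => NumSort;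
  msrsym := unit; rdom := fun _ => [:: NumSort; PowSort]
|}.

Definition nat_pow_structure : msstructure nat_pow_signature :=
  @MSStructure nat_pow_signature
    (fun s => match s with NumSort => nat | PowSort => set nat end)
    (fun _ ab => (ab.1 + ab.2.1)%N)
    (fun _ aA => aA.2.1 aA.1).

(* Main.v *)
(** Write [supp h] for the support of [h].  For [m = t^c], [c] lies outside
    [supp f] iff [f = m * (v + m' * r)] with [v] purely infinite, [m' != 1] a
    monomial of the valuation ring and [r] in the valuation ring, so the relation
    "[c] lies in [supp f]" between [t^c] and [f] is definable.  Fix [c > 0] and
    use [s = \sum_n t^(nc)] as a parameter.  The number [n] is coded by [t^(nc)];
    the codes are the monomials in [supp s], and addition of numbers is
    multiplication of codes.  A set [A] of numbers is coded by any [f] such that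
    [A] is the set of the [n] with [nc] in [supp f]. *)
Require Import Defs.
From mathcomp Require Import all_boot all_order all_algebra.
From mathcomp Require Import boolp classical_sets functions cardinality fsbigop.
From mathcomp Require Import wochoice.
Import Order.TTheory GRing.Theory.
Set Implicit Arguments.
Unset Strict Implicit.
Local Open Scope ring_scope.

(** * Shifts by monomials and the criterion for a vanishing coefficient *)

Section HahnSeries.
Variables (k : fieldType) (G : orderedZmodType).
Implicit Types (a b c : G) (f g : hahn k G).

Lemma hahn_monomialE a b : hahn_monomial k a b = (b == a)%:R.
Proof. by []. Qed.

Lemma hahn_addE f g a : hahn_add f g a = f a + g a.
Proof. by []. Qed.

Lemma hahn_monomial_inj : injective (@hahn_monomial k G).
Proof.
move=> a b /(congr1 (fun f : hahn k G => f a)).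
rewrite !hahn_monomialE eqxx; case: eqP => // _ /eqP.
by rewrite oner_eq0.
Qed.

Lemma hahn_mul_monomialE a f b : hahn_mul (hahn_monomial k a) f b = f (b - a).
Proof.
(* Since [hahn_monomial k a] vanishes away from [a], only the pair [(a, b - a)] contributes to the
   convolution sum. *)
rewrite /= /hahn_mul_coef -(@fsbig_widen _ _ _ _ [set (a, b - a)]%classic).
- by rewrite fsbig_set1 /= eqxx mul1r.
- by move=> _ -> /=; rewrite addrC subrK.
move=> [a' b'] /= [/= <- ne]; case: eqP => [aE|]; last by rewrite mul0r.
by case: ne; rewrite aE addrC addrA addNr add0r.
Qed.

Lemma hahn_mul_monomial a b :
  hahn_mul (hahn_monomial k a) (hahn_monomial k b) = hahn_monomial k (a + b).
Proof.
by apply: hahnP => c; rewrite hahn_mul_monomialE !hahn_monomialE subr_eq addrC.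
Qed.

Lemma valuation_ring_monomial a : valuation_ring (hahn_monomial k a) <-> 0 <= a.
Proof.
split=> [|a0 c]; first by apply; rewrite inE /= eqxx oner_eq0.
by rewrite inE /=; case: (c =P a) => [->|]; rewrite ?eqxx.
Qed.

Lemma hahn_restrict_subproof (P : pred G) f :
  wo_chain <=%R (supp (fun c => if P c then f c else 0)).
Proof.
apply: wo_chainS (@supp_wo _ _ f) => c; rewrite !inE.
by case: ifP; rewrite ?eqxx.
Qed.

Definition hahn_restrict (P : pred G) f := Hahn (@hahn_restrict_subproof P f).

(** The least exponent of [f] serves as [d]: it is nonnegative, and it is not 0 because
    [f 0 = 0]. *)
Lemma supp_ge_pos f : (exists c : G, 0 < c) -> valuation_ring f -> f 0 = 0 ->
  exists2 d, 0 < d & forall c, c \in supp f -> d <= c.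
Proof.
move=> [p p0] f_ge0 f0.
have [nz|z] := pselect (exists c, c \in supp f); last first.
  (* The zero series has no least exponent; any positive element bounds its empty support. *)
  by exists p => // c cf; case: z; exists c.
have [|//|d fd dmin] := (wo_chain_leP _).1 (@supp_wo _ _ f) (fun c => c \in supp f).
  by [].
exists d => //; rewrite lt_def f_ge0 // andbT.
by apply: contraTneq fd => ->; rewrite inE f0 eqxx.
Qed.

(** Multiplying by t^(-a) moves the question to the exponent 0. A series has no constant term iff it
    is a purely infinite part plus a part with support bounded below by some [d > 0], and t^d can be
    factored out of the latter. *)
Lemma coef_eq0P f a : (exists c : G, 0 < c) ->
  f a = 0 <-> exists v m r,
    purely_infinite v /\ monomial_group m /\ valuation_ring m /\
    m <> hahn_one k G /\ valuation_ring r /\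
    f = hahn_mul (hahn_monomial k a) (hahn_add v (hahn_mul m r)).
Proof.
move=> Gpos; split=> [fa|].
  pose h := hahn_mul (hahn_monomial k (- a)) f.
  pose v := hahn_restrict (fun c => c < 0) h.
  pose u := hahn_restrict (fun c => 0 <= c) h.
  have hE b : h b = f (b + a) by rewrite /h hahn_mul_monomialE opprK.
  have vE b : v b = if b < 0 then h b else 0 by [].
  have uE b : u b = if 0 <= b then h b else 0 by [].
  have [||d d0 dmin] := @supp_ge_pos u Gpos.
  - by move=> c; rewrite inE uE; case: ifP; rewrite ?eqxx.
  - by rewrite uE lexx hE add0r.
  (* Here t^(-a) f = v + u, where [u] has all its exponents at least [d], so t^(-d) u lies in the
     valuation ring. *)
  exists v, (hahn_monomial k d), (hahn_mul (hahn_monomial k (- d)) u).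
  split; first by move=> c; rewrite inE vE; case: ifP; rewrite ?eqxx.
  split; first by exists d.
  split; first by apply/valuation_ring_monomial/ltW.
  split; first by move/hahn_monomial_inj => dE; rewrite dE ltxx in d0.
  split.
    move=> c; rewrite inE hahn_mul_monomialE opprK => /dmin.
    by rewrite -{1}[d]add0r oz_leD2r.
  apply: hahnP => b; rewrite hahn_mul_monomialE hahn_addE !hahn_mul_monomialE.
  rewrite opprK subrK vE uE oz_leNgt hE subrK.
  by case: ifP; rewrite ?addr0 ?add0r.
move=> [v [_ [r [v_inf [[d ->] [d_ge0 [d1 [r_ge0 ->]]]]]]]].
rewrite hahn_mul_monomialE subrr hahn_addE hahn_mul_monomialE sub0r.
have -> : v 0 = 0.
  by apply/eqP; apply: contraT => /v_inf; rewrite ltxx.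
(* A nonzero coefficient of [r] at [- d] would give [d <= 0], hence [d = 0] and the monomial t^d
   would be 1. *)
rewrite add0r; apply/eqP; apply: contraT => /r_ge0.
rewrite -(oz_leD2r d) addNr add0r => d_le0.
by case: d1; congr hahn_monomial; apply/le_anti; rewrite d_le0 (valuation_ring_monomial _).1.
Qed.

End HahnSeries.

(** * Series supported on the natural multiples of a positive element *)

Section Multiples.
Variables (G : orderedZmodType) (c : G).
Hypothesis c_gt0 : 0 < c.

Lemma ltr_mulrn_pos : {homo GRing.natmul c : m n / (m < n)%N >-> m < n}.
Proof.
apply: homo_ltn => [|n]; first exact: lt_trans.
by rewrite mulrSr -{1}[c *+ n]addr0 addrC [X in _ < X]addrC oz_ltD2r.
Qed.

Lemma ler_mulrn_pos : {homo GRing.natmul c : m n / (m <= n)%N >-> m <= n}.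
Proof.
by move=> m n; rewrite leq_eqVlt => /orP[/eqP->//|/ltr_mulrn_pos/ltW].
Qed.

Lemma mulrn_pos_inj : injective (GRing.natmul c).
Proof.
by move=> m n; case: (ltngtP m n) => // /ltr_mulrn_pos mn mnE; rewrite mnE ltxx in mn.
Qed.

(** The map from n to nc is increasing, so a least index yields a least element. *)
Lemma wo_multiples (P : pred G) :
  (forall g, P g -> exists n, g = c *+ n) -> wo_chain <=%R P.
Proof.
move=> Pc; apply/wo_chain_leP => S SP [x Sx].
have /ex_minnP[n /asboolP Sn nmin] : exists n, `[< S (c *+ n) >].
  by have [n xE] := Pc x (SP _ Sx); exists n; apply/asboolP; rewrite -xE.
exists (c *+ n) => // y Sy; have [m yE] := Pc y (SP y Sy).
by rewrite yE; apply/ler_mulrn_pos/nmin/asboolP; rewrite -yE.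
Qed.

Variable k : fieldType.

Definition multiples_coef (A : set nat) (g : G) : k :=
  (`[< exists2 n, A n & g = c *+ n >])%:R.

Lemma multiples_coef_subproof A : wo_chain <=%R (supp (multiples_coef A)).
Proof.
apply: wo_multiples => g; rewrite /supp /multiples_coef /=.
by case: asboolP => [[n _ ->] _|]; [exists n | rewrite eqxx].
Qed.

Definition multiples_series A := Hahn (@multiples_coef_subproof A).

Lemma multiples_series_neq0 A g :
  multiples_series A g <> 0 <-> exists2 n, A n & g = c *+ n.
Proof.
rewrite /= /multiples_coef; case: asboolP => [Ag|nAg]; split=> //.
by move=> _; apply/eqP/oner_neq0.
Qed.

End Multiples.

(** * Defining formulas and the coding of numbers and sets *)

Section Formulas.
Variables (k : fieldType) (G : orderedZmodType).
Notation L := hahn_language.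
Notation M := (hahn_structure k G).

Definition addT (t u : term L) : term L :=
  App (L := L) (f := FAdd) (fun i => if val i is 0%N then t else u).
Definition mulT (t u : term L) : term L :=
  App (L := L) (f := FMul) (fun i => if val i is 0%N then t else u).
Definition oneT : term L := App (L := L) (f := FOne) (fun=> Var L 0).
Definition relF (r : hahn_rsym) (t : term L) : formula L :=
  Rel (L := L) (r := r) (fun=> t).

(* Bound variables are 10, 11, 12, so [x] and [y] must be below 10. *)
Definition in_suppF (x y : nat) : formula L :=
  Not (Exists 10 (Exists 11 (Exists 12
    (And (relF RComplement (Var L 10))
    (And (relF RMonomialGroup (Var L 11))
    (And (relF RValuationRing (Var L 11))
    (And (Not (Equal (Var L 11) oneT))
    (And (relF RValuationRing (Var L 12))
      (Equal (Var L x)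
        (mulT (Var L y) (addT (Var L 10) (mulT (Var L 11) (Var L 12))))))))))))).

(** This is [coef_eq0P] negated; the bounds on [x] and [y] keep them clear of the quantified
    variables. *)
Lemma holds_in_supp (e : nat -> M) (x y : nat) (a : G) : (exists c : G, 0 < c) ->
  (x < 10)%N -> (y < 10)%N -> e y = hahn_monomial k a ->
  holds e (in_suppF x y) <-> coef (e x) a <> 0.
Proof.
move=> Gpos x_lt y_lt ey; apply: not_iff_compat; rewrite coef_eq0P // -ey.
have neq z : (z < 10)%N -> (z == 10 = false) * (z == 11 = false) * (z == 12 = false).
  by move=> z_lt; split; [split|]; apply/ltn_eqF/(leq_trans z_lt).
rewrite /= !neq //.
Qed.

Variable c : G.
Hypothesis c_gt0 : 0 < c.

Definition nat_code (n : nat) : M := hahn_monomial k (c *+ n).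
Definition all_nats : M := multiples_series c_gt0 k setT.

(* Variable 9 is the parameter [all_nats]. *)
Definition is_natF (x : nat) : formula L :=
  And (relF RMonomialGroup (Var L x)) (in_suppF 9 x).

Lemma holds_is_nat (e : nat -> M) (x : nat) : (x < 10)%N -> e 9%N = all_nats ->
  holds e (is_natF x) <-> exists n, e x = nat_code n.
Proof.
move=> x_lt e9; have Gpos : exists c : G, 0 < c by exists c.
split=> [[[a exE]]|[n exE]].
  move/(holds_in_supp (x:=9) Gpos erefl x_lt exE).
  by rewrite e9 => /multiples_series_neq0[n _ aE]; exists n; rewrite /nat_code -aE.
split; first by exists (c *+ n).
apply/(holds_in_supp (x:=9) Gpos erefl x_lt exE).
by rewrite e9; apply/multiples_series_neq0; exists n.
Qed.

Definition num_domain (x : seq M) : Prop := exists n, nth all_nats x 0 = nat_code n.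
Definition num_map (x : seq M) : nat := xget 0%N (fun n => nth all_nats x 0 = nat_code n).
(** Only the vanishing or not of the coefficients at the multiples of [c] counts, so a set has many
    codes and equality of sets is not equality of codes. *)
Definition pow_map (x : seq M) : set nat := fun n => coef (nth all_nats x 0) (c *+ n) <> 0.

Lemma nat_code_inj : injective nat_code.
Proof. by move=> m n /hahn_monomial_inj/mulrn_pos_inj; apply. Qed.

(** [xget] chooses some number with code [x]; injectivity of the coding makes it [n]. *)
Lemma num_map_code (x : M) (t : seq M) n : x = nat_code n -> num_map (x :: t) = n.
Proof.
by move=> xE; apply: nat_code_inj; rewrite -xE /num_map /=; case: xgetP => [m _ ->|/(_ n)].
Qed.

End Formulas.

Opaque in_suppF is_natF.

(** * The interpretation and the definability of its pullbacks *)

Theorem theorem5p1 (k : fieldType) (G : orderedZmodType)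
    (G_nontrivial : exists c : G, c != 0) :
  interprets (hahn_structure k G) nat_pow_structure.
Proof.
have [c c_gt0] : exists c : G, 0 < c.
  have [c c0] := G_nontrivial.
  have [|c_gt0] := boolP (c <= 0); last by exists c; rewrite oz_ltNge.
  move=> c_le0; exists (- c); rewrite -(oz_ltD2r c) add0r addNr.
  by rewrite lt_neqAle c0.
have Gpos : exists c : G, 0 < c by exists c.
pose s := all_nats k c_gt0.
(* Numbers and sets are both coded by single series. *)
exists (fun=> 1%N).
exists (fun S => if S is NumSort then num_domain (k := k) c_gt0 else fun=> True).
exists (fun S => match S return seq (hahn_structure k G) -> nat_pow_structure S with
  | NumSort => num_map (k := k) c_gt0 | PowSort => pow_map (k := k) c_gt0 end).
split.
- case.
    exists (is_natF 0), (fun=> s) => x.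
    (* Variable 9 lies beyond the only coordinate, so it keeps the parameter value [s]. *)
    by rewrite (holds_is_nat (c_gt0 := c_gt0)) // nth_default ?size_tuple.
  by exists (Equal (Var _ 0) (Var _ 0)), (fun=> s).
- case=> [n|A] /=.
    exists [tuple nat_code k c n]; first by exists n.
    exact: (num_map_code c_gt0).
  (* The sum of t^(nc) over [n] in [A] codes [A]. *)
  exists [tuple (multiples_series c_gt0 k A : hahn_structure k G)] => //.
  apply/funext => n; apply/propext; rewrite /pow_map [nth _ _ _]/=.
  rewrite multiples_series_neq0; split=> [[m Am]|An]; last by exists n.
  by move/(mulrn_pos_inj c_gt0) => ->.
- case.
    exists (And (is_natF 0) (And (is_natF 1) (Equal (Var _ 0) (Var _ 1)))), (fun=> s).
    case/tupleP=> x; case/tupleP=> y z; rewrite (tuple0 z) /=.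
    rewrite !(holds_is_nat (c_gt0 := c_gt0)) //=.
    split=> [[[m /= xE] [[n /= yE]]]|[[m /= xE] [[n /= yE] xy]]].
      rewrite (num_map_code c_gt0 _ xE) (num_map_code c_gt0 _ yE) => mn.
      split; first by exists m.
      by split; [exists n | rewrite xE yE mn].
    split; first by exists m.
    by split; [exists n | rewrite /= xy].
  (* Two series code the same set iff their supports contain the same multiples nc; variable 2 runs
     over the codes t^(nc). *)
  exists (Forall 2 (Defs.Implies (is_natF 2) (And (Defs.Implies (in_suppF 0 2) (in_suppF 1 2))
    (Defs.Implies (in_suppF 1 2) (in_suppF 0 2))))), (fun=> s).
  case/tupleP=> x; case/tupleP=> y z; rewrite (tuple0 z) /=.
  split=> [[_ [_ xy]] u|xy].
    rewrite (holds_is_nat (c_gt0 := c_gt0)) //= => -[n uE].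
    rewrite !(holds_in_supp (a := c *+ n)) //=.
    by move/(congr1 (fun A : set nat => A n)): xy ; rewrite /pow_map /= => ->.
  do 2!split=> //; apply/funext => n; apply/propext.
  have := xy (nat_code k c n).
  rewrite (holds_is_nat (c_gt0 := c_gt0)) //= !(holds_in_supp (a := c *+ n)) //=.
  by case=> //; exists n.
- case; exists (And (is_natF 0) (in_suppF 1 0)), (fun=> s).
  case/tupleP=> x; case/tupleP=> y z; rewrite (tuple0 z) /=.
  rewrite (holds_is_nat (c_gt0 := c_gt0)) //=.
  split=> [[[n /= xE] [_]]|[[n /= xE]]].
    rewrite (num_map_code c_gt0 _ xE) => yn; split; first by exists n.
    by rewrite (holds_in_supp (a := c *+ n)).
  rewrite (holds_in_supp (a := c *+ n)) //= => yn; split; first by exists n.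
  by split=> //; rewrite (num_map_code c_gt0 _ xE).
(* The value is coordinate 0: t^(lc) = t^(mc) t^(nc) holds iff l = m + n. *)
- case; exists (And (is_natF 0) (And (is_natF 1) (And (is_natF 2)
    (Equal (Var _ 0) (mulT (Var _ 1) (Var _ 2)))))), (fun=> s).
  case/tupleP=> x; case/tupleP=> y; case/tupleP=> z w; rewrite (tuple0 w) /=.
  rewrite !(holds_is_nat (c_gt0 := c_gt0)) //=.
  split=> [[[l /= xE] [[m /= yE] [[n /= zE]]]]|[[l /= xE] [[m /= yE] [[n /= zE] xyz]]]].
    rewrite (num_map_code c_gt0 _ xE) (num_map_code c_gt0 _ yE) (num_map_code c_gt0 _ zE) => lmn.
    split; first by exists l.
    split; first by exists m.
    split; first by exists n.
    by rewrite xE yE zE /nat_code hahn_mul_monomial lmn mulrnDr.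
  split; first by exists l.
  split; first by exists m.
  split; first by exists n.
  rewrite (num_map_code c_gt0 _ xE) (num_map_code c_gt0 _ yE) (num_map_code c_gt0 _ zE).
  apply: (nat_code_inj (k := k) c_gt0).
  by rewrite -xE xyz yE zE /nat_code hahn_mul_monomial mulrnDr.
Qed.
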